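(* Let $(\mathfrak g,J,\langle\cdot,\cdot\rangle)$ be an SKT Lie algebra with $\mathfrak g$ nilpotent. Then $\mathfrak g$ is at most $2$-step nilpotent, i.e. $[\mathfrak g,[\mathfrak g,\mathfrak g]]=0$.
   Context: All Lie algebras are finite-dimensional and real. A Hermitian Lie algebra is a triple $(\mathfrak g,J,\langle\cdot,\cdot\rangle)$ where $\mathfrak g$ is a real Lie algebra, $J:\mathfrak g\to\mathfrak g$ is linear with $J^2=-\mathrm{Id}$ and satisfies the integrability condition $[JX,JY]=[X,Y]+J[JX,Y]+J[X,JY]$ for all $X,Y$, and $\langle\cdot,\cdot\rangle$ is an inner product with $\langle J\cdot,J\cdot\rangle=\langle\cdot,\cdot\rangle$. Its Bismut torsion $3$-form is $$c(U,Y,Z)=-\langle[JU,JY],Z\rangle-\langle[JY,JZ],U\rangle-\langle[JZ,JU],Y\rangle,$$ with exterior derivative $$dc(W,U,Y,Z)=-c([W,U],Y,Z)+c([W,Y],U,Z)-c([W,Z],U,Y)-c([U,Y],W,Z)+c([U,Z],W,Y)-c([Y,Z],W,U).$$ $(\mathfrak g,J,\langle\cdot,\cdot\rangle)$ is called SKT (an SKT Lie algebra) if $dc=0$. *)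

(* Defs.v *)
From HB Require Import structures.
From mathcomp Require Import all_boot all_order all_algebra.
From mathcomp Require Import reals.

Set Implicit Arguments.
Unset Strict Implicit.
Unset Printing Implicit Defensive.

Import Order.TTheory GRing.Theory Num.Theory.
Local Open Scope ring_scope.

Definition is_lie (R : realType) (g : vectType R)
    (br : {bilinear g -> g -> g}) : Prop :=
  (forall x, br x x = 0) /\
  (forall x y z, br x (br y z) + br y (br z x) + br z (br x y) = 0).

(* The subspace [U, V] spanned by the brackets of elements of U and V; by
   bilinearity, brackets of basis elements suffice (see lie_prodP). *)
Definition lie_prod (R : realType) (g : vectType R)
    (br : {bilinear g -> g -> g}) (U V : {vspace g}) : {vspace g} :=
  <<[seq br u v | u <- vbasis U, v <- vbasis V]>>%VS.

(* Lower central series: g, [g, g], [g, [g, g]], ... *)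
Fixpoint lie_lcs (R : realType) (g : vectType R)
    (br : {bilinear g -> g -> g}) (n : nat) : {vspace g} :=
  if n is n'.+1 then lie_prod br fullv (lie_lcs br n') else fullv.

Definition lie_nilpotent (R : realType) (g : vectType R)
    (br : {bilinear g -> g -> g}) : Prop :=
  exists n, lie_lcs br n = 0%VS.

(* {dot g for idfun} is the library's type of inner products on g: symmetric
   positive definite bilinear forms. *)
Record is_hermitian_lie (R : realType) (g : vectType R)
    (br : {bilinear g -> g -> g}) (J : 'End(g)) (ip : {dot g for idfun}) :
    Prop := IsHermitianLie {
  hermitian_lie_bracket : is_lie br;
  hermitian_lie_JJ : forall x, J (J x) = - x;
  hermitian_lie_integrable : forall x y,
    br (J x) (J y) = br x y + J (br (J x) y) + J (br x (J y));
  hermitian_lie_isometry : forall x y, ip (J x) (J y) = ip x y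
}.

Definition bismut_torsion (R : realType) (g : vectType R)
    (br : {bilinear g -> g -> g}) (J : 'End(g)) (ip : {dot g for idfun})
    (u y z : g) : R :=
  - ip (br (J u) (J y)) z - ip (br (J y) (J z)) u - ip (br (J z) (J u)) y.

(* Chevalley-Eilenberg differential of a 3-form c. *)
Definition lie_d3 (R : realType) (g : vectType R)
    (br : {bilinear g -> g -> g}) (c : g -> g -> g -> R) (w u y z : g) : R :=
  - c (br w u) y z + c (br w y) u z - c (br w z) u y
  - c (br u y) w z + c (br u z) w y - c (br y z) w u.

Definition is_SKT (R : realType) (g : vectType R)
    (br : {bilinear g -> g -> g}) (J : 'End(g)) (ip : {dot g for idfun}) :
    Prop :=
  is_hermitian_lie br J ip /\
  (forall w u y z, lie_d3 br (bismut_torsion br J ip) w u y z = 0).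

Lemma lie_prodP (R : realType) (g : vectType R)
    (br : {bilinear g -> g -> g}) (U V W : {vspace g}) :
  reflect {in U & V, forall u v, br u v \in W} (lie_prod br U V <= W)%VS.
Proof.
apply: (iffP idP) => [sUVW u v Uu Vv | sUVW].
  apply: (subvP sUVW).
  rewrite (coord_vbasis Uu) (coord_vbasis Vv).
  rewrite linear_sumlz; apply: memv_suml => i _.
  rewrite linear_sumr; apply: memv_suml => j _.
  rewrite linearZl_LR linearZr_LR !memvZ // memv_span //.
  by apply/allpairsP; exists ((vbasis U)`_i, (vbasis V)`_j); rewrite !memt_nth.
apply/span_subvP=> _ /allpairsP[[u v] /= [Uu Vv ->]].
by rewrite sUVW ?vbasis_mem.
Qed.

(* Main.v *)
Require Import Defs.
From mathcomp Require Import all_boot all_order all_algebra.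
From mathcomp Require Import reals.
From mathcomp Require Import lra.
Import Order.TTheory GRing.Theory Num.Theory.
Local Open Scope ring_scope.

(**
Write z(A) for the center of a J-stable subalgebra A, and g^j for the lower
central series of g.  If x in A satisfies [x, Jx] = 0, and [x, A] and J[x, A]
lie in z(A) with [x, A] orthogonal to x, then downward induction on j shows that
x and Jx commute with A :&: g^j: for y in this intersection all other terms of
the SKT equation vanish, leaving
   - dc(x, Jx, y, Jy) = |[x,y]|^2 + |[x,Jy]|^2 + |[Jx,y]|^2 + |[Jx,Jy]|^2.
Hence z(A) is J-stable, and an element x of the second center of A with
[x, Jx] = 0 is central.

The subalgebras s_j = g^j + J g^j satisfy [s_j, s_j] <= s_{j+1}, so it suffices
to show that A is 2-step nilpotent when [A, A] <= S <= A for some J-stable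
2-step S.  First, z(S) <= z(A).  Next, let x in [A, A] be in the second center
of A, let y in A and r = [Jx, y].  As [Jx, S] is central,
0 = [Jx, [Jx, [y, Jy]]] = 2 [r, [Jx, Jy]] = 2 [r, Jr], so r is in z(S) and hence
in z(A).  Thus Jx is in the second center, which commutes with [A, A], so
[x, Jx] = 0 and x is central.
*)

(** * Inner products and orthogonal projection *)

Section InnerProduct.
Set Implicit Arguments.
Unset Strict Implicit.
Variables (R : realType) (g : vectType R) (ip : {dot g for idfun}).

Lemma dot_sym x y : ip x y = ip y x.
Proof. by rewrite hermC expr0 mul1r. Qed.

Lemma dot_gt0 x : x != 0 -> 0 < ip x x.
Proof. exact: neq0_dnorm_gt0. Qed.

Lemma dot_ge0 x : 0 <= ip x x.
Proof.
have [->|/dot_gt0/ltW//] := eqVneq x 0.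
by rewrite linear0r.
Qed.

Lemma dot_eq0 x : ip x x = 0 -> x = 0.
Proof. by have [->//|/dot_gt0] := eqVneq x 0; move=> /[swap] ->; rewrite ltxx. Qed.

Lemma orthogonal_projection (W : {vspace g}) x :
  exists2 p, p \in W & {in W, forall w, ip (x - p) w = 0}.
Proof.
suff span_proj s : forall x, exists2 p, p \in <<s>>%VS &
    {in <<s>>%VS, forall w, ip (x - p) w = 0}.
  by rewrite -(span_basis (vbasisP W)).
elim: s => [|e s IHs] {}x.
  exists 0; rewrite ?mem0v // => w; rewrite span_nil memv0 => /eqP->.
  by rewrite linear0r.
have [q q_s oq] := IHs e; have [p p_s op] := IHs x.
(* Gram-Schmidt: [f] is the part of [e] orthogonal to the span of [s]. It may vanish, and then the
   value of [t] is immaterial. *)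
pose f := e - q; pose t := ip (x - p) f / ip f f.
exists (p + t *: f).
  rewrite addrC span_cons /f scalerBr -addrA memv_add ?memvZ ?memv_line //.
  by rewrite memvD // memvN memvZ.
have of_s w : w \in <<s>>%VS -> ip (x - (p + t *: f)) w = 0.
  move=> w_s; rewrite opprD addrA linearBl linearZl_LR /=.
  by rewrite op // oq // mulr0 subrr.
move=> w; rewrite span_cons => /memv_addP[_ /vlineP[k ->] [w' w's ->]].
rewrite linearDr /= (of_s w') // addr0 linearZr_LR /=.
suff -> : ip (x - (p + t *: f)) e = 0 by rewrite mulr0.
rewrite -(subrK q e) linearDr /= (of_s q) // addr0 opprD addrA linearBl linearZl_LR /=.
have [f0|/dot_gt0 f_gt0] := eqVneq f 0; first by rewrite -/f f0 !linear0r mulr0 subrr.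
by rewrite -/f /t divfK ?subrr // gt_eqF.
Qed.

End InnerProduct.

(** * Brackets and induction along the lower central series *)

Section Nilpotent.
Set Implicit Arguments.
Unset Strict Implicit.
Variables (R : realType) (g : vectType R) (br : {bilinear g -> g -> g}).
Hypothesis br_lie : is_lie br.

Lemma bracket_antisym x y : br x y = - br y x.
Proof.
have [brxx _] := br_lie; have := brxx (x + y).
rewrite linearDl /= !linearDr /= !brxx addr0 add0r => /eqP.
by rewrite addr_eq0 => /eqP.
Qed.

Lemma bracket_derivation x y z :
  br x (br y z) = br (br x y) z + br y (br x z).
Proof.
have [_ jac] := br_lie; have := jac x y z.
rewrite [br z (br x y)]bracket_antisym [br z x]bracket_antisym.
by rewrite linearNr /= => /eqP; rewrite -addrA addr_eq0 opprD !opprK addrC => /eqP.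
Qed.

Lemma lcs_bracketr j x y : y \in lie_lcs br j -> br x y \in lie_lcs br j.+1.
Proof. by move=> yj; apply: (lie_prodP _ _ _ _ (subvv _)) => //; apply: memvf. Qed.

Lemma lcs_bracketl j x y : y \in lie_lcs br j -> br y x \in lie_lcs br j.+1.
Proof. by move=> yj; rewrite bracket_antisym memvN lcs_bracketr. Qed.

Lemma lcs_descending_ind (P : nat -> Prop) : lie_nilpotent br ->
    (forall j, lie_lcs br j = 0%VS -> P j) ->
    (forall j, P j.+1 -> P j) -> P 0%N.
Proof.
move=> [N lcsN] P0 step; have := P0 N lcsN.
by elim: N {lcsN} => // N IHN /step.
Qed.

(** Suited to claims about brackets: [[x, y]] lies one term deeper in the series than [y], where the
    property is already known. *)
Lemma nilpotent_ind (P : g -> Prop) : lie_nilpotent br -> P 0 ->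
    (forall j, {in lie_lcs br j.+1, forall y, P y} ->
               {in lie_lcs br j, forall y, P y}) ->
  forall y, P y.
Proof.
move=> nil P0 step y.
suff: {in lie_lcs br 0, forall y, P y} by apply; apply: memvf.
apply: (lcs_descending_ind (P := fun j => {in lie_lcs br j, forall y, P y})) => //.
by move=> j -> {}y; rewrite memv0 => /eqP->.
Qed.

End Nilpotent.

(** * Centers of complex subalgebras under the SKT condition *)

Section SKT.
Set Implicit Arguments.
Unset Strict Implicit.
Variables (R : realType) (g : vectType R).
Variables (br : {bilinear g -> g -> g}) (J : 'End(g)) (ip : {dot g for idfun}).
Hypotheses (skt : is_SKT br J ip) (nil : lie_nilpotent br).

Let herm := skt.1.
Let lie := hermitian_lie_bracket herm.
Let JJ := hermitian_lie_JJ herm.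
Let integrable := hermitian_lie_integrable herm.
Let isometry := hermitian_lie_isometry herm.
Let brC := bracket_antisym lie.
Let brD := bracket_derivation lie.
Let brxx x : br x x = 0 := lie.1 x.

Definition complex_subalgebra (A : {vspace g}) : Prop :=
  {in A, forall x, J x \in A} /\ {in A & A, forall x y, br x y \in A}.

Definition centralizes (A : {vspace g}) (x : g) : Prop :=
  {in A, forall y, br x y = 0}.

Lemma SKT_kills_bracket (A : {vspace g}) x : complex_subalgebra A -> x \in A ->
    br x (J x) = 0 ->
    {in A, forall y, centralizes A (br x y)} ->
    {in A, forall y, centralizes A (J (br x y))} ->
    {in A, forall y, ip (br x y) x = 0} ->
  centralizes A x /\ centralizes A (J x).
Proof.
move=> [JA brA] xA brxJx cA cJA ox.
suff P y : y \in A -> br x y = 0 /\ br (J x) y = 0.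
  by split=> y /P[].
move: y; apply: (nilpotent_ind nil) => [|j IH y yj yA].
  by split; apply: linear0r.
have JxA := JA x xA; have JyA := JA y yA.
pose a := br x y; pose b := br x (J y); pose d := br (J x) y.
pose e := br (J x) (J y); pose B := br y (J y).
have dA : d \in A by apply: brA.
have BA : B \in A by apply: brA.
(* [d] and [B] lie one term deeper than [y], so the induction hypothesis covers them. It does not
   cover [e], since [J y] need not lie in the same term as [y]. *)
have [xd Jxd] := IH _ (lcs_bracketr (J x) yj) dA.
have [xB JxB] := IH _ (lcs_bracketl lie (J y) yj) BA.
(* Modulo elements central in [A], integrability says that [J d = e] and [J e = - d]. *)
have eE : e = a + J d + J b := integrable x y.
have JdE : J d = e - a - J b by rewrite eE addrAC addrK addrC addKr.
have JeE : J e = J a - d - b by rewrite eE !linearD /= !JJ.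
have cent u v : v \in A -> centralizes A u -> br v u = 0.
  by move=> vA uA; rewrite brC uA // oppr0.
have ca : centralizes A a by apply: cA.
have cJa : centralizes A (J a) by apply: cJA.
have cb : centralizes A b by apply: cA.
have cJb : centralizes A (J b) by apply: cJA.
have xe : br x e = 0.
  by rewrite /e brD brxJx linear0l add0r cent.
have xJd : br x (J d) = 0.
  by rewrite JdE !linearBr /= xe (cent a) // (cent (J b)) // !subr0.
have JxJd : br (J x) (J d) = 0.
  by rewrite integrable xd Jxd xJd linear0 !addr0.
have JxJe : br (J x) (J e) = 0.
  by rewrite JeE !linearBr /= Jxd (cent (J a)) // (cent b) // !subr0.
have yJd : br y (J d) = br y e.
  by rewrite JdE !linearBr /= (cent a) // (cent (J b)) // !subr0.
have JyJe : br (J y) (J e) = - br (J y) d.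
  by rewrite JeE !linearBr /= (cent (J a)) // (cent b) // sub0r subr0.
have JxJB : br (J x) (J B) = J (br x (J B)).
  by rewrite integrable xB JxB linear0 !add0r.
(* Jacobi turns [[J x, B] = 0] into [[y, e] = [J y, d]], so the two mixed terms of dc cancel; those
   in [J B] vanish because [[x, A]] is orthogonal to [x]. *)
have BE : ip (br y e) x = ip (br (J y) d) x.
  have : br (J x) B = 0 by [].
  rewrite /B brD -/d -/e => /eqP; rewrite addr_eq0 => /eqP.
  by rewrite [br (J y) d]brC => ->; rewrite opprK.
have := skt.2 x (J x) y (J y).
rewrite /lie_d3 -/a -/b -/d -/e -/B brxJx /bismut_torsion !JJ.
rewrite !(linear0, linear0l, linear0r, linearNl, linearNr, opprK, subr0, oppr0) /=.
rewrite (cJa x) // (cJb x) // (cent (J a)) // (cent (J b)) //.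
rewrite [br (J d) _]brC JxJd [br (J e) _]brC JxJe yJd JyJe [br (J B) _]brC JxJB.
rewrite [br (J x) x]brC brxJx !oppr0 -/a -/b -/d -/e !linearNl /= isometry.
rewrite ox ?JA // !linear0l BE => sum0.
have := dot_ge0 ip a; have := dot_ge0 ip b.
have := dot_ge0 ip d; have := dot_ge0 ip e => *.
by split; apply: (dot_eq0 (ip := ip)); lra.
Qed.

Lemma center_J (A : {vspace g}) x : complex_subalgebra A -> x \in A ->
  centralizes A x -> centralizes A (J x).
Proof.
move=> subA xA cx; have [JA _] := subA.
apply SKT_kills_bracket => //; first by rewrite cx ?JA.
- by move=> y yA z _; rewrite cx // linear0l.
- by move=> y yA z _; rewrite cx // linear0 linear0l.
- by move=> y yA; rewrite cx // linear0l.
Qed.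

(* Subtracting from x its projection onto [x, A], which is central in A, does
   not change the brackets of x. *)
Lemma second_center_central (A : {vspace g}) x : complex_subalgebra A ->
    x \in A -> {in A, forall y, centralizes A (br x y)} -> br x (J x) = 0 ->
  centralizes A x.
Proof.
move=> subA xA cx xJx; have [JA brA] := subA.
have [_ /memv_imgP[y yA ->]] := orthogonal_projection ip (linfun (br x) @: A) x.
rewrite lfunE /= => oxy; set p := br x y in oxy.
have pA : p \in A by apply: brA.
have cp : centralizes A p by apply: cx.
have cJp : centralizes A (J p) by apply: center_J.
have brE z : z \in A -> br (x - p) z = br x z.
  by move=> zA; rewrite linearBl /= cp // subr0.
have [] := @SKT_kills_bracket A (x - p) => //.
- by rewrite memvB.
- rewrite linearB /= linearBr /= !brE ?JA // xJx [br x (J p)]brC cJp //.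
  by rewrite oppr0 subr0.
- by move=> z zA; rewrite brE //; apply: cx.
- by move=> z zA; rewrite brE //; apply: center_J (cx z zA); rewrite ?brA.
- by move=> z zA; rewrite brE // dot_sym oxy // -lfunE /= memv_img.
by move=> cxp _ z zA; rewrite -brE // cxp.
Qed.

(** * Two-step subalgebras and their extension *)

Definition two_step (A : {vspace g}) : Prop :=
  {in A & A, forall x y, centralizes A (br x y)}.

Lemma two_step_extension (A S : {vspace g}) :
    complex_subalgebra A -> (S <= A)%VS -> {in S, forall x, J x \in S} ->
    {in A & A, forall x y, br x y \in S} -> two_step S ->
  two_step A.
Proof.
move=> subA /subvP SA JS brS S2; have [JA brA] := subA.
have subS : complex_subalgebra S by split=> // x y /SA xA /SA yA; apply: brS.
(* By Jacobi, brackets of the center of [S] with [A] stay in that center; being deeper in the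
   series, they are central in [A] by induction. *)
have centerS x : x \in S -> centralizes S x -> centralizes A x.
  move: x; apply: (nilpotent_ind nil) => [_ _ y _|j IH x xj xS cx].
    exact: linear0l.
  apply: second_center_central => // [|y yA|]; [exact: SA| |by rewrite cx ?JS].
  have xyS : br x y \in S by apply: brS => //; apply: SA.
  apply: IH => // [|s sS]; first exact: lcs_bracketl.
  have ysS : br y s \in S by apply: brS => //; apply: SA.
  by have := brD x y s; rewrite (cx s sS) (cx _ ysS) linear0r addr0.
suff derA x : x \in lie_prod br A A -> centralizes A x.
  by move=> x y xA yA; apply: derA; apply: (lie_prodP _ _ _ _ (subvv _)).
have der_in u v : u \in A -> v \in A -> br u v \in lie_prod br A A.
  by move=> uA vA; apply: (lie_prodP _ _ _ _ (subvv _)).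
have derS : (lie_prod br A A <= S)%VS by apply/lie_prodP.
move: x; apply: (nilpotent_ind nil) => [_ y _|j IH x xj xder].
  exact: linear0l.
have xS : x \in S by apply: (subvP derS).
have xA := SA x xS; have JxS := JS x xS; have JxA := SA _ JxS.
have cx y : y \in A -> centralizes A (br x y).
  by move=> yA; apply: IH; [apply: lcs_bracketl|apply: der_in].
have cent u v : v \in A -> centralizes A u -> br v u = 0.
  by move=> vA uA; rewrite brC uA // oppr0.
have cJx y : y \in A -> centralizes A (br (J x) y).
  move=> yA; have JyA := JA y yA.
  set r := br (J x) y; set r' := br (J x) (J y).
  have rS : r \in S by apply: brS.
  have r'S : r' \in S by apply: brS.
  have cS u : u \in S -> centralizes A (br (J x) u).
    by move=> uS; apply: centerS; [apply: brS; rewrite ?SA|apply: S2].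
  (* Applying ad [J x] twice to [[y, J y]] gives [2 [r, r']]: the outer Leibniz terms contain
     [[J x, r]] or [[J x, r']], which are central by [cS]. *)
  have rr' : br r r' = 0.
    have : br (J x) (br (J x) (br y (J y))) = 0.
      apply: (cent); rewrite ?SA //; apply: cS; exact: brS.
    rewrite [br _ (br y _)]brD -/r -/r' linearDr /=.
    rewrite [br _ (br r _)]brD [br _ (br y r')]brD -/r -/r'.
    rewrite cS // (cent (br (J x) r')) //; last exact: cS.
    rewrite add0r addr0 => /eqP; rewrite -mulr2n -scaler_nat scaler_eq0.
    by rewrite pnatr_eq0 => /eqP.
  (* By integrability, [J r] and [r'] differ by elements central in [A]. *)
  have rJr : br r (J r) = 0.
    have -> : J r = r' - br x y - J (br x (J y)).
      by rewrite /r' integrable -/r addrAC addrK addrC addKr.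
    have rA := SA r rS.
    have cJxy : centralizes A (J (br x (J y))).
      by apply: center_J (cx _ JyA) => //; apply: brA.
    by rewrite !linearBr /= rr' (cent _ _ rA (cx y yA)) (cent _ _ rA cJxy) !subr0.
  (* As [S] is two-step, [r] is in its second center, and [[r, J r] = 0] makes it central in [S]. *)
  apply: centerS => //; apply: second_center_central => //.
  by move=> u uS; apply: S2.
have xJx : br x (J x) = 0.
  (* The kernel of ad [J x] contains [[A, A]] because [[J x, A]] is central. *)
  rewrite brC; apply/eqP; rewrite oppr_eq0 -[br _ _](lfunE (br (J x))) -memv_ker.
  apply: subvP xder; apply/lie_prodP => u v uA vA.
  by rewrite memv_ker lfunE /= brD cJx // (cent _ u) ?addr0 //; apply: cJx.
exact: second_center_central.
Qed.

Lemma SKT_two_step : two_step fullv.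
Proof.
pose s j := (lie_lcs br j + J @: lie_lcs br j)%VS.
have mem_lcs j u : u \in lie_lcs br j -> u \in s j.
  by move=> uj; apply: subvP uj; apply: addvSl.
have mem_J j u : u \in lie_lcs br j -> J u \in s j.
  by move=> uj; apply: (subvP (addvSr _ _)); apply: memv_img.
have Js j : {in s j, forall x, J x \in s j}.
  move=> _ /memv_addP[u uj [_ /memv_imgP[v vj ->] ->]].
  by rewrite linearD /= JJ memvD ?memvN ?mem_J // mem_lcs.
have br_s j : {in s j & s j, forall x y, br x y \in s j.+1}.
  move=> _ _ /memv_addP[u uj [_ /memv_imgP[v vj ->] ->]]
    /memv_addP[u' uj' [_ /memv_imgP[v' vj' ->] ->]].
  (* Integrability trades a bracket of two [J]-images for brackets with an entry in the j-th term,
     up to applying [J]. *)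
  rewrite linearDl /= !linearDr /= integrable.
  by rewrite !memvD //; (apply: mem_J || apply: mem_lcs);
    (exact: lcs_bracketr || exact: lcs_bracketl).
have lcs_sub j : (lie_lcs br j.+1 <= lie_lcs br j)%VS.
  elim: j => [|j IHj]; first exact: subvf.
  by apply/lie_prodP => u v _ /(subvP IHj); apply: lcs_bracketr.
have s_sub j : (s j.+1 <= s j)%VS by rewrite addvS ?limgS.
have s_alg j : complex_subalgebra (s j).
  by split=> // x y xs ys; apply: subvP (br_s j x y xs ys).
suff s2 : two_step (s 0%N).
  by move=> x y _ _ z _; apply: s2; apply: mem_lcs; apply: memvf.
apply: (lcs_descending_ind (P := fun j => two_step (s j)) nil) => j.
  rewrite /s => -> x y; rewrite limg0 addv0 memv0 => /eqP-> _ z _.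
  by rewrite !linear0l.
by move=> s2; apply: two_step_extension (s_sub j) (Js j.+1) (br_s j) s2.
Qed.

End SKT.

Theorem theorem4p8 (R : realType) (g : vectType R)
    (br : {bilinear g -> g -> g}) (J : 'End(g)) (ip : {dot g for idfun})
    (hSKT : is_SKT br J ip) (hnil : lie_nilpotent br) :
  lie_prod br fullv (lie_prod br fullv fullv) = 0%VS.
Proof.
apply/eqP; rewrite -subv0; apply/lie_prodP => x y _ der_y.
have [[lie _ _ _] _] := hSKT.
rewrite memv0 -[br x y](lfunE (br x)) -memv_ker.
apply: subvP der_y; apply/lie_prodP => u v _ _.
rewrite memv_ker lfunE /= [br x _](bracket_antisym lie) oppr_eq0; apply/eqP.
by apply: (SKT_two_step hSKT hnil); apply: memvf.
Qed.
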